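(* Let $d\ge1$ and $\sigma>0$. Let $P$ be a $K$-subgaussian distribution on $\mathbb{R}^d$ with $0<K<\frac{\sigma}{2}$, and let $S\sim P$, $Y=S+Z$ with $Z\sim\mathcal{N}_\sigma$ independent of $S$. Then $$I_{\chi^2}(S;Y)\;\le\; c:=\exp\left(2d\Big(\frac K\sigma\Big)^2\frac{\sigma^2-2K^2}{\sigma^2-4K^2}\right)<\infty .$$ Consequently, for every $n\in\mathbb{N}$, $$\mathbb{E}_{P^{\otimes n}}\,\chi^2\big(\hat P_{S^n}\ast\mathcal{N}_\sigma\,\big\|\,P\ast\mathcal{N}_\sigma\big)\le \frac{c}{n}.$$
   Context: A distribution $P$ on $\mathbb{R}^d$ is $K$-subgaussian ($K>0$) if $X\sim P$ satisfies $\mathbb{E}\big[\exp(\alpha^T(X-\mathbb{E}X))\big]\le \exp\big(\tfrac12K^2\|\alpha\|^2\big)$ for all $\alpha\in\mathbb{R}^d$. $\mathcal{N}_\sigma=\mathcal{N}(0,\sigma^2\mathrm{I}_d)$; $S^n=(S_1,\dots,S_n)\sim P^{\otimes n}$; $\hat P_{S^n}=\frac1n\sum_{i=1}^n\delta_{S_i}$; $\ast$ is convolution of measures. $\chi^2(\mu\|\nu)=\int\big(\frac{d\mu}{d\nu}-1\big)^2d\nu$. The $\chi^2$ mutual information is $I_{\chi^2}(S;Y)=\chi^2(P_{S,Y}\|P_S\otimes P_Y)$, where $P_{S,Y}$ is the joint law of $(S,Y)$ and $P_S,P_Y$ are its marginals. *)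

(* Defs.v *)
From HB Require Import structures.
From mathcomp Require Import all_boot all_order all_algebra.
From mathcomp Require Import all_classical all_reals all_analysis.
From mathcomp Require Import measurable_realfun.

Set Implicit Arguments.
Unset Strict Implicit.
Unset Printing Implicit Defensive.

Import Order.TTheory GRing.Theory Num.Theory.
Import numFieldNormedType.Exports.

Local Open Scope classical_set_scope.
Local Open Scope ring_scope.

(* R^d is represented by d.-tuple R. The library's sigma-algebra on tuples is
   generated by the coordinate projections; over the Borel sets of R it is the
   Borel sigma-algebra of R^d. *)

Definition vadd (R : realType) (d : nat) (x y : d.-tuple R) : d.-tuple R :=
  [tuple tnth x i + tnth y i | i < d].

Definition vsub (R : realType) (d : nat) (x y : d.-tuple R) : d.-tuple R :=
  [tuple tnth x i - tnth y i | i < d].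

Definition vdot (R : realType) (d : nat) (x y : d.-tuple R) : R :=
  \sum_(i < d) tnth x i * tnth y i.

(* The square of the Euclidean norm. *)
Definition vsqnorm (R : realType) (d : nat) (x : d.-tuple R) : R :=
  \sum_(i < d) tnth x i ^+ 2.

Section convolution.
Context (R : realType) (d : nat).

Definition vadd_pair (z : d.-tuple R * d.-tuple R) : d.-tuple R :=
  vadd z.1 z.2.

Lemma measurable_vadd_pair : measurable_fun [set: _] vadd_pair.
Proof.
apply/measurable_fun_tnthP => i.
rewrite (_ : _ \o _ = fun z => tnth z.1 i + tnth z.2 i); last first.
  by apply/funext => z /=; rewrite tnth_mktuple.
by apply: measurable_funD;
  apply: (measurableT_comp (measurable_tnth i)).
Qed.

HB.instance Definition _ :=
  isMeasurableFun.Build _ _ _ _ vadd_pair measurable_vadd_pair.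

Definition convolution (mu nu : probability (d.-tuple R) R) :
    probability (d.-tuple R) R :=
  distribution (mu \x nu)%E vadd_pair.

End convolution.

Section joint.
Context d d1 d2 (T : measurableType d) (T1 : measurableType d1)
  (T2 : measurableType d2).

Definition rv_pair (X : {mfun T >-> T1}) (Y : {mfun T >-> T2}) (w : T) :
  T1 * T2 := (X w, Y w).

Variables (X : {mfun T >-> T1}) (Y : {mfun T >-> T2}).

Let measurable_rv_pair : measurable_fun [set: _] (rv_pair X Y).
Proof. exact: measurable_fun_pair. Qed.

HB.instance Definition _ :=
  isMeasurableFun.Build _ _ _ _ (rv_pair X Y) measurable_rv_pair.

End joint.

Definition independent d d1 d2 (T : measurableType d) (T1 : measurableType d1)
    (T2 : measurableType d2) (R : realType) (Pr : probability T R)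
    (X : {RV Pr >-> T1}) (Y : {RV Pr >-> T2}) : Prop :=
  forall (A : set T1) (B : set T2), measurable A -> measurable B ->
  Pr (X @^-1` A `&` Y @^-1` B) = (Pr (X @^-1` A) * Pr (Y @^-1` B))%E.

Section iid.
Context (d : measure_display) (T : measurableType d).

Definition cons_pair n (z : T * n.-tuple T) : n.+1.-tuple T :=
  [tuple of z.1 :: z.2].

Lemma measurable_cons_pair n : measurable_fun [set: _] (@cons_pair n).
Proof. exact: measurable_cons. Qed.

HB.instance Definition _ n :=
  isMeasurableFun.Build _ _ _ _ (@cons_pair n) (@measurable_cons_pair n).

Context (R : realType).

(* The n-fold product measure, by induction on n through the identification
   of T^(n+1) with T * T^n; iidE below is its defining property. *)
Fixpoint iid (P : probability T R) (n : nat) : probability (n.-tuple T) R :=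
  match n return probability (n.-tuple T) R with
  | 0%N => dirac ([tuple] : 0.-tuple T)
  | m.+1 => distribution (P \x iid P m)%E (@cons_pair m)
  end.

Lemma iidE (P : probability T R) n (A : 'I_n -> set T) :
  (forall i, measurable (A i)) ->
  iid P n [set s | forall i, A i (tnth s i)] = (\prod_(i < n) P (A i))%E.
Proof.
elim: n A => [|n IHn] A mA.
  by rewrite big_ord0 /= diracE mem_set// => -[].
rewrite big_ord_recl -(IHn (fun i => A (lift ord0 i)))//.
rewrite -product_measure1E//; last first.
  rewrite (_ : [set _ | _] =
      \bigcap_(i in [set: 'I_n]) ((@tnth _ _ ^~ i) @^-1` A (lift ord0 i))).
    apply: fin_bigcap_measurable => // i _.
    by rewrite -[X in measurable X]setTI; exact: measurable_tnth.
  by apply/seteqP; split => [s sA i _|s sA i]; [exact: sA|exact: (sA i)].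
rewrite /= /distribution /pushforward; congr ((_ \x _)%E _).
apply/seteqP; split => -[x s] /= => [sA|[xA sA] i].
  split; first exact: (sA ord0).
  by move=> i; have := sA (lift ord0 i); rewrite tnthS.
by case: (unliftP ord0 i) => [j ->|->//]; rewrite tnthS.
Qed.

End iid.

Section gaussian.
Context (R : realType).

(* normal_prob lives on measurableTypeR R, which has the same carrier and the
   same measurable sets as R but another display; transporting it along the
   identity makes it a probability on R. *)
Definition idTR : measurableTypeR R -> R := idfun.

HB.instance Definition _ :=
  @isMeasurableFun.Build _ _ _ _ idTR (@measurable_id _ _ setT).

Definition normal (m sigma : R) : probability R R :=
  distribution (normal_prob m sigma) idTR.

(* N(0, sigma^2 I_d): the coordinates are independent with law N(0, sigma^2);
   the second parameter of normal_prob is the standard deviation. *)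
Definition gaussian (d : nat) (sigma : R) : probability (d.-tuple R) R :=
  iid (normal 0 sigma) d.

End gaussian.

Section empirical.
Local Open Scope ereal_scope.
Context (d : measure_display) (T : measurableType d) (R : realType) (n : nat).
Variable s : n.+1.-tuple T.

Definition empirical (A : set T) : \bar R :=
  (n.+1%:R^-1)%R%:E * \sum_(i < n.+1) \d_(tnth s i) A.

Let empirical0 : empirical set0 = 0.
Proof. by rewrite /empirical big1 ?mule0// => i _; rewrite measure0. Qed.

Let empirical_ge0 A : 0 <= empirical A.
Proof. by rewrite /empirical mule_ge0 ?lee_fin ?sume_ge0. Qed.

Let empirical_sigma_additive : semi_sigma_additive empirical.
Proof.
rewrite (_ : empirical = mscale ((n.+1%:R^-1)%:nng)%R
    (msum (fun k => dirac (nth (thead s) s k)) n.+1)).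
  exact: measure_semi_sigma_additive.
apply/funext => A; rewrite /empirical /mscale/= /msum; congr (_ * _).
by apply: eq_bigr => i _; rewrite (tnth_nth (thead s)).
Qed.

HB.instance Definition _ := isMeasure.Build _ _ _ empirical
  empirical0 empirical_ge0 empirical_sigma_additive.

Let empirical_setT : empirical [set: _] = 1.
Proof.
rewrite /empirical (eq_bigr (fun=> 1%:E)); last by move=> i _; rewrite diracT.
by rewrite sumEFin sumr_const card_ord -EFinM mulVf.
Qed.

HB.instance Definition _ :=
  Measure_isProbability.Build _ _ _ empirical empirical_setT.

End empirical.

Local Open Scope charge_scope.

(* As usual for f-divergences, the value is +oo when mu is not absolutely
   continuous with respect to nu. *)
Definition chi2_div d (T : measurableType d) (R : realType)
    (mu nu : probability T R) : \bar R :=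
  if `[< mu `<< nu >] then
    (\int[nu]_x (('d (charge_of_finite_measure mu) '/d nu) x - 1) ^+ 2)%E
  else +oo%E.

Definition chi2_info d d1 d2 (T : measurableType d) (T1 : measurableType d1)
    (T2 : measurableType d2) (R : realType) (Pr : probability T R)
    (X : {RV Pr >-> T1}) (Y : {RV Pr >-> T2}) : \bar R :=
  chi2_div (distribution Pr (rv_pair X Y))
           (distribution Pr X \x distribution Pr Y)%E.

Definition mean (R : realType) (d : nat) (P : probability (d.-tuple R) R) :
    d.-tuple R :=
  [tuple fine 'E_P[fun x => tnth x i] | i < d].

(* Integrability of the coordinates is what makes E X meaningful: the
   library's integral of a non-integrable function is a junk value. *)
Definition subgaussian (R : realType) (d : nat) (K : R)
    (P : probability (d.-tuple R) R) : Prop :=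
  (forall i : 'I_d, P.-integrable [set: _] (fun x => (tnth x i)%:E)) /\
  forall a : d.-tuple R,
    ('E_P[fun x => expR (vdot a (vsub x (mean P)))] <=
     (expR (2^-1 * K ^+ 2 * vsqnorm a))%:E)%E.

(* Main.v *)
Require Import Defs.
From HB Require Import structures.
From mathcomp Require Import all_boot all_order all_algebra.
From mathcomp Require Import all_classical all_reals all_analysis.
From mathcomp Require Import measurable_realfun ring lra.

Set Implicit Arguments.
Unset Strict Implicit.
Unset Printing Implicit Defensive.

Import Order.TTheory GRing.Theory Num.Theory.
Import numFieldNormedType.Exports.

Local Open Scope classical_set_scope.
Local Open Scope ring_scope.

(** Let m be the mean of P, a = x - m the centred input, and write
    rho(a, z) = exp((<a, z> - |a|^2 / 2) / sigma^2), which is the density at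
    m + z of the law N(x, sigma^2 I) with respect to N(m, sigma^2 I). The output
    law P * N_sigma has density q(z) = E rho(S - m, z) with respect to the same
    reference, so the joint law of (S, Y) has density
    f(x, y) = rho(x - m, y - m) / q(y - m) with respect to the product of its
    marginals. The Gaussian N(m, sigma^2 I) thus plays the part usually given to
    Lebesgue measure on R^d, and its translates are compared through the shift
    identity [ge0_integral_gaussian_shift], which reduces to one dimension by
    induction on d.

    Everything rests on the number M = (1 - 2 r)^(-d/2) with r = (K / sigma)^2,
    which is used twice.
    - [subgaussian_expR_vsqnorm]: E exp(|S - m|^2 / sigma^2) <= M. The square in
      the exponent is linearised by an auxiliary Gaussian average, after which
      the subgaussian bound applies and leaves a Gaussian integral.
    - [mixture_lower_bound]: M q(z) >= 1 for all z. This is a form of Jensen's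
      inequality, obtained from exp u >= 1 + u and E (S - m) = 0.

    The second point bounds the integral of f(x, .)^2 under the output law by
    M times the integral of rho(x - m, .)^2 under N_sigma, which equals
    M exp(|x - m|^2 / sigma^2); averaging over x with the first point gives
    E (f - 1)^2 <= E f^2 <= M^2 ([integral_channel_density_sqr_dev_le]). Finally
    M^2 = (1 - 2 r)^(-d) <= exp(2 d r / (1 - 2 r)), and
    1 / (1 - 2 r) <= (1 - 2 r) / (1 - 4 r), so M^2 <= c
    ([gaussian_constant_le]).

    For the empirical measure, the smoothed law of the sample s has density
    the average of the f(s_i, .) with respect to P * N_sigma. For each fixed y
    the variables f(s_i, y) are independent and bounded with mean 1, so the
    second moment of the average of the f(s_i, y) - 1 is 1/n times that of one
    term ([integral_iid_mean_sqr_dev]); integrating over y gives 1/n times the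
    quantity already bounded. *)

(** * Measures given by a density *)

Section density.
Local Open Scope ereal_scope.
Local Open Scope charge_scope.
Context d (T : measurableType d) (R : realType).

Lemma density_dominates (nu : {measure set T -> \bar R})
    (mu : {measure set T -> \bar R}) (f : T -> \bar R) :
  measurable_fun setT f ->
  (forall A, measurable A -> mu A = \int[nu]_(x in A) f x) ->
  mu `<< nu.
Proof.
move=> mf muE; apply/null_content_dominatesP => A mA nuA0.
by rewrite muE// null_set_integral//; exact: measurable_funTS.
Qed.

Lemma ge0_integral_density (nu : {sigma_finite_measure set T -> \bar R})
    (mu : {finite_measure set T -> \bar R}) (f g : T -> \bar R) :
  measurable_fun setT f -> (forall x, 0 <= f x) ->
  (forall A, measurable A -> mu A = \int[nu]_(x in A) f x) ->
  measurable_fun setT g -> (forall x, 0 <= g x) ->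
  \int[mu]_x g x = \int[nu]_x (g x * f x).
Proof.
move=> mf f0 muE mg g0.
have munu := density_dominates mf muE.
pose h := Radon_Nikodym_SigmaFinite.f mu nu.
have ih := Radon_Nikodym_SigmaFinite.f_integrable munu.
rewrite -(Radon_Nikodym_SigmaFinite.change_of_variables munu)//.
apply: ae_eq_integral => //.
- by apply: emeasurable_funM => //; exact: measurable_int ih.
- exact: emeasurable_funM.
- apply: ae_eqe_mul2l; apply: integral_ae_eq => // A _ mA.
  by rewrite -Radon_Nikodym_SigmaFinite.f_integral// muE.
Qed.

(** Radon-Nikodym derivatives are unique almost everywhere, so any explicit
    density computes the divergence. *)
Lemma density_chi2_div (nu mu : probability T R) (f : T -> R) :
  measurable_fun setT f -> (forall x, (0 <= f x)%R) ->
  (forall A, measurable A -> mu A = \int[nu]_(x in A) (f x)%:E) ->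
  chi2_div mu nu = \int[nu]_x ((f x - 1) ^+ 2)%:E.
Proof.
move=> mf f0 muE.
have mfE : measurable_fun setT (EFin \o f) by exact/measurable_EFinP.
have munu := density_dominates mfE muE.
rewrite /chi2_div asboolT//.
have i := Radon_Nikodym_integrable (nu := charge_of_finite_measure mu) munu.
have m := measurable_int _ i.
apply: ae_eq_integral => //.
- under eq_fun do rewrite expe2.
  by apply: emeasurable_funM; exact: emeasurable_funB.
- apply/measurable_EFinP/measurable_funX; exact: measurable_funB.
- have : ae_eq nu setT ('d (charge_of_finite_measure mu) '/d nu) (EFin \o f).
    apply: integral_ae_eq => // A _ mA.
    by rewrite -Radon_Nikodym_integral//= -muE.
  by apply: filterS => x /(_ I) /= -> _.
Qed.

End density.

(** * The normal law on the line *)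

Section normal_law.
Context (R : realType).
Local Open Scope ereal_scope.

(** Lebesgue measure is characterised by its values on half-open intervals,
    whose lengths a translation preserves. *)
Lemma lebesgue_measure_shift (a : R) (A : set R) : measurable A ->
  pushforward lebesgue_measure (+%R a : _ -> measurableTypeR R) A =
  lebesgue_measure A.
Proof.
have ma : measurable_fun setT (+%R a : measurableTypeR R -> measurableTypeR R).
  by apply: measurable_funD; [exact: measurable_cst|exact: measurable_id].
pose f : {mfun measurableTypeR R >-> measurableTypeR R} :=
  HB.pack (+%R a) (isMeasurableFun.Build _ _ _ _ _ ma).
move=> mA; apply/esym.
apply: (lebesgue_measure_unique
  (mu := pushforward lebesgue_measure f)) => //= _ [[b c]] _ <-.
rewrite /pushforward.
rewrite (_ : _ @^-1` _ = `](b - a)%R, (c - a)%R]%classic); last first.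
  apply/seteqP; split => x /=; rewrite !in_itv/=; lra.
rewrite !lebesgue_measure_itv/= !lte_fin ltrD2r; case: ifP => // _.
by rewrite -!EFinB; congr EFin; lra.
Qed.

Lemma ge0_integral_shift (a : R) (f : R -> \bar R) :
  measurable_fun setT f -> (forall x, 0 <= f x) ->
  \int[lebesgue_measure]_x f (a + x)%R = \int[lebesgue_measure]_x f x.
Proof.
move=> mf f0.
have ma : measurable_fun setT (+%R a : measurableTypeR R -> measurableTypeR R).
  by apply: measurable_funD; [exact: measurable_cst|exact: measurable_id].
pose g : {mfun measurableTypeR R >-> measurableTypeR R} :=
  HB.pack (+%R a) (isMeasurableFun.Build _ _ _ _ _ ma).
transitivity (\int[pushforward lebesgue_measure g]_x f x).
  by rewrite ge0_integral_pushforward//=.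
apply: eq_measure_integral => A mA _; exact: lebesgue_measure_shift.
Qed.

(** [normal] carries the default display of [R] and [lebesgue_measure] that of
    [measurableTypeR R]; stating the change of density here confines the
    passage between the two to this lemma. *)
Lemma ge0_integral_normal (m s : R) (f : R -> \bar R) :
  measurable_fun setT f -> (forall x, 0 <= f x) ->
  \int[normal m s]_x f x =
  \int[lebesgue_measure]_x (f x * (normal_pdf m s x)%:E).
Proof.
move=> mf f0.
rewrite ge0_integral_pushforward//=.
rewrite /comp /idTR /=.
apply: (@ge0_integral_density _ (measurableTypeR R) R lebesgue_measure
  (normal_prob m s) (fun x => (normal_pdf m s x)%:E)) => //.
- by apply/measurable_EFinP; exact: measurable_normal_pdf.
- by move=> x; rewrite lee_fin normal_pdf_ge0.
Qed.

(** The factor is the quotient of the densities of N(a, s^2) and N(0, s^2). *)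
Lemma ge0_integral_normal_shift (a s : R) (f : R -> \bar R) : s != 0%R ->
  measurable_fun setT f -> (forall x, 0 <= f x) ->
  \int[normal 0 s]_x f (a + x)%R =
  \int[normal 0 s]_x (f x * (expR ((a * x - 2^-1 * a ^+ 2) / s ^+ 2))%:E).
Proof.
move=> s0 mf f0.
have mfa : measurable_fun setT (fun x : R => f (a + x)%R).
  by apply: measurableT_comp => //; exact: measurable_funD.
have mr : measurable_fun setT
    (fun x : R => (expR ((a * x - 2^-1 * a ^+ 2) / s ^+ 2))%:E).
  apply/measurable_EFinP/measurableT_comp => //.
  by apply: measurable_funM => //; apply: measurable_funB => //;
    exact: measurable_funM.
rewrite !ge0_integral_normal//; last 2 first.
- exact: emeasurable_funM.
- by move=> x; rewrite mule_ge0// lee_fin expR_ge0.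
pose g x := f x * (normal_pdf 0 s (x - a))%:E.
transitivity (\int[lebesgue_measure]_x g (a + x)%R).
  apply: eq_integral => x _; rewrite /g.
  by congr (_ * (normal_pdf _ _ _)%:E); ring.
rewrite ge0_integral_shift; last 2 first.
- apply: emeasurable_funM => //; apply/measurable_EFinP.
  apply: (measurableT_comp (measurable_normal_pdf 0 s)).
  exact: measurable_funB.
- by move=> x; rewrite mule_ge0// lee_fin normal_pdf_ge0.
apply: eq_integral => x _; rewrite /g -muleA -EFinM; congr (_ * _%:E).
rewrite !normal_pdfE// mulrCA; congr (_ * _)%R.
rewrite /normal_fun -expRD; congr expR.
by field.
Qed.

(** Multiplying the density of N(0, s^2) by exp(t x^2) gives a multiple of the
    density of the centred normal law with standard deviation
    s / sqrt(1 - 2 t s^2). *)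
Lemma integral_normal_expR_sqr (t s : R) : (0 < s)%R ->
  (0 < 1 - 2 * t * s ^+ 2)%R ->
  \int[normal 0 s]_x (expR (t * x ^+ 2))%:E =
  ((Num.sqrt (1 - 2 * t * s ^+ 2))^-1)%:E.
Proof.
move=> s0; set v := (1 - _)%R => v0.
have mf : measurable_fun setT (fun x : R => (expR (t * x ^+ 2))%:E).
  apply/measurable_EFinP/measurableT_comp => //.
  exact: measurable_funM.
rewrite ge0_integral_normal//.
pose s' : R := (s / Num.sqrt v)%R.
have sv0 : (0 < Num.sqrt v)%R by rewrite sqrtr_gt0.
have s'0 : (0 < s')%R by rewrite divr_gt0.
have vE : (Num.sqrt v ^+ 2 = v)%R by rewrite sqr_sqrtr// ltW.
transitivity (\int[lebesgue_measure]_x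
    ((Num.sqrt v)^-1%:E * (normal_pdf 0 s' x)%:E)).
  apply: eq_integral => x _; rewrite -!EFinM; congr EFin.
  rewrite !normal_pdfE ?gt_eqF// mulrCA [RHS]mulrA.
  congr (_ * _)%R.
    rewrite /normal_peak -!mulrnAr !(sqrtrM _ (sqr_ge0 _)) !sqrtr_sqr.
    rewrite !gtr0_norm// /s'.
    have p0 : (0 < Num.sqrt (pi *+ 2 : R))%R.
      by rewrite sqrtr_gt0 pmulrn_lgt0// pi_gt0.
    by field; rewrite !gt_eqF.
  rewrite /normal_fun -expRD; congr expR; rewrite !subr0 /s' expr_div_n vE /v.
  by field; rewrite -/v !gt_eqF.
rewrite (integralZl (mu := @lebesgue_measure R)) //; last first.
  exact: integrable_normal_pdf.
by rewrite integral_normal_pdf mule1.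
Qed.

End normal_law.

(** * Integration against product measures *)

Section iid_integral.
Local Open Scope ereal_scope.
Context d (T : measurableType d) (R : realType) (P : probability T R).

Lemma integral_iid0 (f : 0.-tuple T -> \bar R) :
  measurable_fun setT f -> \int[iid P 0]_s f s = f [tuple].
Proof. by move=> mf; rewrite integral_dirac// diracT mul1e. Qed.

Lemma ge0_integral_iidS n (f : n.+1.-tuple T -> \bar R) :
  measurable_fun setT f -> (forall s, 0 <= f s) ->
  \int[iid P n.+1]_s f s =
  \int[P]_x \int[iid P n]_t f (cons_pair (x, t)).
Proof.
move=> mf f0; rewrite ge0_integral_pushforward//=.
rewrite fubini_tonelli1//.
by apply: measurableT_comp => //; exact: measurable_cons_pair.
Qed.

Lemma ge0_integral_iid_prod n (f : T -> R) (c : R) :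
  measurable_fun setT f -> (forall x, (0 <= f x)%R) ->
  \int[P]_x (f x)%:E = c%:E ->
  \int[iid P n]_s (\prod_(i < n) f (tnth s i))%:E = (c ^+ n)%:E.
Proof.
move=> mf f0 fc; have mprod m : measurable_fun setT
    (fun s : m.-tuple T => (\prod_(i < m) f (tnth s i))%:E).
  apply/measurable_EFinP; apply: measurable_prod => i _.
  by apply: measurableT_comp => //; exact: measurable_tnth.
elim: n => [|n IHn].
  by rewrite integral_iid0// big_ord0 expr0.
rewrite ge0_integral_iidS//; last first.
  by move=> s; rewrite lee_fin prodr_ge0.
transitivity (\int[P]_x ((c ^+ n)%:E * (f x)%:E)).
  apply: eq_integral => x _.
  rewrite muleC -IHn -ge0_integralZl//; last 3 first.
  - exact: mprod.
  - by move=> t _; rewrite lee_fin prodr_ge0.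
  - by rewrite lee_fin.
  apply: eq_integral => t _; rewrite big_ord_recl tnth0 EFinM.
  by congr (_ * _%:E); apply: eq_bigr => i _; rewrite tnthS.
rewrite ge0_integralZl// ?fc -?EFinM ?exprSr//.
- exact/measurable_EFinP.
- by move=> x _; rewrite lee_fin.
- rewrite lee_fin exprn_ge0// -lee_fin -fc integral_ge0// => x _.
  by rewrite lee_fin.
Qed.

(** The second moment of a sum of centred independent variables. The shift [b]
    makes the induction go through: after integrating out the other
    coordinates, the first one only changes [b] into [b + h x]. The integrand
    being nonnegative throughout, Tonelli's theorem suffices. *)
Lemma integral_iid_sum_sqr n (h : T -> R) (b v : R) :
  P.-integrable setT (EFin \o h) ->
  P.-integrable setT (fun x => (h x ^+ 2)%:E) ->
  \int[P]_x (h x)%:E = 0 ->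
  \int[P]_x (h x ^+ 2)%:E = v%:E ->
  \int[iid P n]_s ((b + \sum_(i < n) h (tnth s i)) ^+ 2)%:E =
  (b ^+ 2 + n%:R * v)%:E.
Proof.
move=> ih ih2 h0 hv; have mh : measurable_fun setT h.
  exact/measurable_EFinP/(measurable_int _ ih).
have msum m c : measurable_fun setT
    (fun s : m.-tuple T => ((c + \sum_(i < m) h (tnth s i)) ^+ 2)%:E).
  apply/measurable_EFinP/measurable_funX/measurable_funD => //.
  apply: measurable_sum => i.
  by apply: measurableT_comp => //; exact: measurable_tnth.
elim: n b => [|n IHn] b.
  by rewrite integral_iid0// big_ord0 addr0 mul0r addr0.
rewrite ge0_integral_iidS//; last first.
  by move=> s; rewrite lee_fin sqr_ge0.
transitivity (\int[P]_x ((b ^+ 2 + n%:R * v)%:E +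
    ((2 * b)%:E * (h x)%:E + (h x ^+ 2)%:E))).
  apply: eq_integral => x _.
  transitivity (\int[iid P n]_t
      ((b + h x + \sum_(i < n) h (tnth t i)) ^+ 2)%:E).
    apply: eq_integral => t _; rewrite big_ord_recl tnth0 addrA.
    by congr ((_ + _) ^+ 2)%:E; apply: eq_bigr => i _; rewrite tnthS.
  rewrite IHn -EFinM -!EFinD; congr EFin; ring.
rewrite integralD//; last 2 first.
- exact: finite_measure_integrable_cst.
- by apply: integrableD => //; exact: integrableZl.
rewrite integral_cst//= probability_setT mule1 integralD//; last first.
  exact: integrableZl.
rewrite integralZl// h0 mule0 add0e hv -EFinD; congr EFin.
by rewrite -natr1; ring.
Qed.

End iid_integral.

(** * Gaussian vectors *)

Section vectors.
Context (R : realType).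

Lemma vadd_cons d (a x : R) (u v : d.-tuple R) :
  vadd (cons_pair (a, u)) (cons_pair (x, v)) = cons_pair (a + x, vadd u v).
Proof.
apply: eq_from_tnth => i; rewrite tnth_mktuple.
by case: (unliftP ord0 i) => [j ->|->]; rewrite ?tnthS ?tnth_mktuple.
Qed.

Lemma vdot_cons d (a x : R) (u v : d.-tuple R) :
  vdot (cons_pair (a, u)) (cons_pair (x, v)) = a * x + vdot u v.
Proof.
rewrite /vdot big_ord_recl; congr +%R.
by apply: eq_bigr => i _; rewrite !tnthS.
Qed.

Lemma vsqnorm_cons d (a : R) (u : d.-tuple R) :
  vsqnorm (cons_pair (a, u)) = a ^+ 2 + vsqnorm u.
Proof.
rewrite /vsqnorm big_ord_recl; congr +%R.
by apply: eq_bigr => i _; rewrite !tnthS.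
Qed.

Context d d' (T : measurableType d') (f g : T -> d.-tuple R).
Hypotheses (mf : measurable_fun setT f) (mg : measurable_fun setT g).

Let mtnth (h : T -> d.-tuple R) i :
  measurable_fun setT h -> measurable_fun setT (fun x => tnth (h x) i).
Proof. by move=> mh; exact: (measurableT_comp (measurable_tnth i)). Qed.

Lemma measurable_vadd : measurable_fun setT (fun x => vadd (f x) (g x)).
Proof.
apply/measurable_fun_tnthP => i.
rewrite (_ : _ \o _ = fun x => tnth (f x) i + tnth (g x) i); last first.
  by apply/funext => x /=; rewrite tnth_mktuple.
by apply: measurable_funD; exact: mtnth.
Qed.

Lemma measurable_vsub : measurable_fun setT (fun x => vsub (f x) (g x)).
Proof.
apply/measurable_fun_tnthP => i.
rewrite (_ : _ \o _ = fun x => tnth (f x) i - tnth (g x) i); last first.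
  by apply/funext => x /=; rewrite tnth_mktuple.
by apply: measurable_funB; exact: mtnth.
Qed.

Lemma measurable_vdot : measurable_fun setT (fun x => vdot (f x) (g x)).
Proof.
by apply: measurable_sum => i; apply: measurable_funM; exact: mtnth.
Qed.

Lemma measurable_vsqnorm : measurable_fun setT (fun x => vsqnorm (f x)).
Proof.
by apply: measurable_sum => i; apply: measurable_funX; exact: mtnth.
Qed.

End vectors.

(** For s nonzero, the density of N(a, s^2 I) with respect to N(0, s^2 I). *)
Definition tilt (R : realType) (d : nat) (s : R) (a z : d.-tuple R) : R :=
  expR ((vdot a z - 2^-1 * vsqnorm a) / s ^+ 2).

Section gaussian_vectors.
Context (R : realType).
Local Open Scope ereal_scope.

Lemma tilt_ge0 d (s : R) (a z : d.-tuple R) : (0 <= tilt s a z)%R.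
Proof. exact: expR_ge0. Qed.

Lemma measurable_tilt d d' (T : measurableType d') (s : R)
    (f g : T -> d.-tuple R) :
  measurable_fun setT f -> measurable_fun setT g ->
  measurable_fun setT (fun x => tilt s (f x) (g x)).
Proof.
move=> mf mg; apply: measurableT_comp => //.
apply: measurable_funM => //; apply: measurable_funB.
  exact: measurable_vdot.
by apply: measurable_funM => //; exact: measurable_vsqnorm.
Qed.

(** The coordinates are independent, so the one-dimensional factors multiply. *)
Lemma ge0_integral_gaussian_shift d (s : R) (a : d.-tuple R)
    (f : d.-tuple R -> \bar R) : s != 0%R ->
  measurable_fun setT f -> (forall x, 0 <= f x) ->
  \int[gaussian d s]_z f (vadd a z) =
  \int[gaussian d s]_z (f z * (tilt s a z)%:E).
Proof.
move=> s0; have mft n (b : n.-tuple R) (g : n.-tuple R -> \bar R) :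
    measurable_fun setT g ->
    measurable_fun setT (fun z => g z * (tilt s b z)%:E).
  move=> mg; apply: emeasurable_funM => //.
  by apply/measurable_EFinP; exact: measurable_tilt.
have mfa n (b : n.-tuple R) (g : n.-tuple R -> \bar R) :
    measurable_fun setT g -> measurable_fun setT (fun z => g (vadd b z)).
  by move=> mg; apply: measurableT_comp => //; exact: measurable_vadd.
elim: d a f => [|d IHd] a f mf f0.
  rewrite !integral_iid0//; [|exact: mft|exact: mfa].
  rewrite /tilt /vdot /vsqnorm !big_ord0 mulr0 subr0 mul0r expR0 mule1.
  by congr f; exact: tuple0.
case/tupleP: a => a0 a.
have f_cons x : measurable_fun setT (fun t => f (cons_pair (x, t))).
  apply: measurableT_comp => //.
  by apply: measurableT_comp => //; exact: measurable_cons_pair.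
rewrite !ge0_integral_iidS; last 4 first.
- exact: mft.
- by move=> z; rewrite mule_ge0// lee_fin tilt_ge0.
- exact: mfa.
- by move=> z; exact: f0.
pose F x := \int[gaussian d s]_t (f (cons_pair (x, t)) * (tilt s a t)%:E).
have F0 x : 0 <= F x.
  by apply: integral_ge0 => t _; rewrite mule_ge0// lee_fin tilt_ge0.
have mF : measurable_fun setT F.
  apply: (@measurable_fun_fubini_tonelli_F _ _ _ _ R (gaussian d s)
    (fun z => f (cons_pair z) * (tilt s a z.2)%:E)).
    apply: emeasurable_funM.
      by apply: measurableT_comp => //; exact: measurable_cons_pair.
    by apply/measurable_EFinP; exact: measurable_tilt.
  by move=> z; rewrite mule_ge0// lee_fin tilt_ge0.
transitivity (\int[normal 0 s]_x F (a0 + x)%R).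
  apply: eq_integral => x _.
  rewrite /F -(IHd a (fun t => f (cons_pair ((a0 + x)%R, t))))//.
  by apply: eq_integral => t _; congr f; exact: vadd_cons.
apply: (etrans (ge0_integral_normal_shift a0 s0 mF F0)).
apply: eq_integral => x _.
rewrite /F -ge0_integralZr; last 4 first.
- exact: measurableT.
- exact: (mft _ a _ (f_cons x)).
- by move=> t _; rewrite mule_ge0// lee_fin tilt_ge0.
- by rewrite lee_fin expR_ge0.
apply: eq_integral => t _; rewrite -muleA -EFinM; congr (_ * _%:E).
rewrite /tilt -expRD; congr expR.
rewrite (vdot_cons a0 x a t) (vsqnorm_cons a0 a).
by field.
Qed.

Lemma integral_tilt d (s : R) (a : d.-tuple R) : s != 0%R ->
  \int[gaussian d s]_z (tilt s a z)%:E = 1.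
Proof.
move=> s0; have := @ge0_integral_gaussian_shift d s a (cst 1) s0.
rewrite integral_cst//= probability_setT mule1 => -> //.
by apply: eq_integral => z _; rewrite mul1e.
Qed.

End gaussian_vectors.

(** * Exponential moments of subgaussian vectors *)

Definition vscale (R : realType) (d : nat) (c : R) (x : d.-tuple R) :
  d.-tuple R := [tuple c * tnth x i | i < d].

Section moments.
Context (R : realType) (d : nat).
Local Open Scope ereal_scope.
Implicit Types (s K : R) (a x z : d.-tuple R) (P : probability (d.-tuple R) R).

Lemma vdot_scale c a z : vdot (vscale c a) z = (c * vdot a z)%R.
Proof.
by rewrite /vdot mulr_sumr; apply: eq_bigr => i _; rewrite tnth_mktuple mulrA.
Qed.

Lemma vdotC a z : vdot a z = vdot z a.
Proof. by rewrite /vdot; apply: eq_bigr => i _; rewrite mulrC. Qed.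

Lemma vsqnorm_scale c a : vsqnorm (vscale c a) = (c ^+ 2 * vsqnorm a)%R.
Proof.
rewrite /vsqnorm mulr_sumr; apply: eq_bigr => i _.
by rewrite tnth_mktuple exprMn.
Qed.

Lemma vsqnorm_ge0 a : (0 <= vsqnorm a)%R.
Proof. by apply: sumr_ge0 => i _; exact: sqr_ge0. Qed.

(** Completing the square: the integrand is a constant multiple of [tilt s a],
    which is a probability density. *)
Lemma integral_gaussian_expR_vdot s a : s != 0%R ->
  \int[gaussian d s]_z (expR (vdot a z / s ^+ 2))%:E =
  (expR (vsqnorm a / (2 * s ^+ 2)))%:E.
Proof.
move=> s0.
transitivity (\int[gaussian d s]_z
    ((expR (vsqnorm a / (2 * s ^+ 2)))%:E * (tilt s a z)%:E)).
  apply: eq_integral => z _; rewrite -EFinM -expRD; congr (expR _)%:E.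
  by field.
rewrite ge0_integralZl//.
- by rewrite integral_tilt// mule1.
- by apply/measurable_EFinP; exact: measurable_tilt.
- by move=> z _; rewrite lee_fin tilt_ge0.
Qed.

Lemma integral_gaussian_expR_vsqnorm t s : (0 < s)%R ->
  (0 < 1 - 2 * t * s ^+ 2)%R ->
  \int[gaussian d s]_z (expR (t * vsqnorm z))%:E =
  ((Num.sqrt (1 - 2 * t * s ^+ 2))^-1 ^+ d)%:E.
Proof.
move=> s0 t0.
rewrite -(@ge0_integral_iid_prod _ _ _ (normal 0 s) d
  (fun x : R => expR (t * x ^+ 2))
  (Num.sqrt (1 - 2 * t * s ^+ 2))^-1)//; last 2 first.
- by apply: measurableT_comp => //; exact: measurable_funM.
- exact: integral_normal_expR_sqr.
apply: eq_integral => z _; congr EFin.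
by rewrite /vsqnorm mulr_sumr expR_sum.
Qed.

Lemma subgaussian_mgf K P a : subgaussian K P ->
  \int[P]_x (expR (vdot a (vsub x (mean P))))%:E <=
  (expR (2^-1 * K ^+ 2 * vsqnorm a))%:E.
Proof. by move=> [_ /(_ a)]; rewrite unlock. Qed.

(** With Z a Gaussian vector of law N(0, s^2 I) independent of x, and
    a = x - E x, exp(|a|^2 / s^2) is the average over Z of
    exp(sqrt 2 <a, Z> / s^2). Exchanging the averages, the subgaussian bound at
    sqrt 2 Z / s^2 leaves the average of exp(K^2 |Z|^2 / s^4). *)
Lemma subgaussian_expR_vsqnorm K s P :
  (0 < s)%R -> (2 * K ^+ 2 < s ^+ 2)%R -> subgaussian K P ->
  \int[P]_x (expR (vsqnorm (vsub x (mean P)) / s ^+ 2))%:E <=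
  ((Num.sqrt (1 - 2 * (K / s) ^+ 2))^-1 ^+ d)%:E.
Proof.
move=> s0 Ks sub.
have s20 : (0 < s ^+ 2)%R by rewrite exprn_gt0.
pose dev x := vsub x (mean P).
pose c : R := Num.sqrt 2.
have c2 : (c ^+ 2 = 2)%R by rewrite sqr_sqrtr.
have mdev : measurable_fun setT dev by exact: measurable_vsub.
pose f (w : d.-tuple R * d.-tuple R) :=
  (expR (vdot (vscale c (dev w.1)) w.2 / s ^+ 2))%:E.
have mf : measurable_fun setT f.
  rewrite /f; under eq_fun do rewrite vdot_scale.
  apply/measurable_EFinP/measurableT_comp => //; apply: measurable_funM => //.
  apply: measurable_funM => //; apply: measurable_vdot => //.
  exact: measurableT_comp.
have f0 w : 0 <= f w by rewrite lee_fin expR_ge0.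
rewrite (_ : \int[P]_x _ = \int[P]_x \int[gaussian d s]_z f (x, z)); last first.
  apply: eq_integral => x _.
  rewrite [RHS](integral_gaussian_expR_vdot (vscale c (dev x)) (lt0r_neq0 s0)).
  by rewrite vsqnorm_scale c2; congr (expR _)%:E; field; rewrite gt_eqF.
rewrite fubini_tonelli//.
have -> : (1 - 2 * (K / s) ^+ 2 = 1 - 2 * (K ^+ 2 / s ^+ 4) * s ^+ 2)%R.
  by field; rewrite gt_eqF.
rewrite -integral_gaussian_expR_vsqnorm//; last first.
  rewrite subr_gt0 (_ : _ * _ = (2 * K ^+ 2) / s ^+ 2)%R.
    by rewrite ltr_pdivrMr// mul1r.
  by field; rewrite gt_eqF.
apply: ge0_le_integral => //.
- by move=> z _; apply: integral_ge0 => x _.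
- exact: (measurable_fun_fubini_tonelli_G f).
- apply/measurable_EFinP/measurableT_comp => //; apply: measurable_funM => //.
  exact: measurable_vsqnorm.
move=> z _.
have := subgaussian_mgf (vscale (c / s ^+ 2) z) sub.
rewrite vsqnorm_scale expr_div_n c2.
rewrite (_ : (2^-1 * K ^+ 2 * (2 / s ^+ 2 ^+ 2 * vsqnorm z) =
   K ^+ 2 / s ^+ 4 * vsqnorm z)%R); last by field; rewrite gt_eqF.
apply: le_trans; rewrite le_eqVlt; apply/orP; left; apply/eqP.
apply: eq_integral => x _; rewrite /f/=; congr (expR _)%:E.
by rewrite !vdot_scale vdotC mulrAC.
Qed.

Lemma integrable_centered K P z : subgaussian K P ->
  P.-integrable setT (fun x => (vdot (vsub x (mean P)) z)%:E).
Proof.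
move=> [iP _].
rewrite (_ : (fun _ => _) = fun x => \sum_(i < d)
    (tnth z i)%:E * ((tnth x i)%:E + (- tnth (mean P) i)%:E)).
  apply: integrable_sum => // i _; apply: integrableZl => //.
  by apply: integrableD => //; exact: finite_measure_integrable_cst.
apply/funext => x; rewrite /vdot -sumEFin; apply: eq_bigr => i _.
by rewrite tnth_mktuple mulrC.
Qed.

Lemma integral_centered K P z : subgaussian K P ->
  \int[P]_x (vdot (vsub x (mean P)) z)%:E = 0.
Proof.
move=> [iP _].
have ic i : P.-integrable setT
    (fun x => (tnth x i)%:E + (- tnth (mean P) i)%:E).
  by apply: integrableD => //; exact: finite_measure_integrable_cst.
transitivity (\int[P]_x (\sum_(i < d)
    (tnth z i)%:E * ((tnth x i)%:E + (- tnth (mean P) i)%:E))).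
  apply: eq_integral => x _; rewrite /vdot -sumEFin; apply: eq_bigr => i _.
  by rewrite tnth_mktuple mulrC.
rewrite integral_sum//; last by move=> i; exact: integrableZl.
rewrite big1// => i _; rewrite integralZl// integralD//; last first.
  exact: finite_measure_integrable_cst.
rewrite integral_cst//= probability_setT mule1 tnth_mktuple unlock.
rewrite EFinN fineK ?subee ?mule0//; first exact: integrable_fin_num.
exact: integrable_fin_num.
Qed.

End moments.

(** * Gaussian smoothing and the density of the channel *)

Section smoothing.
Context (R : realType) (d : nat).
Local Open Scope ereal_scope.
Implicit Types (a x y z : d.-tuple R) (P mu : probability (d.-tuple R) R).

Lemma vsubK a x : vadd x (vsub a x) = a.
Proof.
by apply: eq_from_tnth => i; rewrite !tnth_mktuple addrC subrK.
Qed.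

Lemma vaddK a x : vsub (vadd x a) x = a.
Proof.
by apply: eq_from_tnth => i; rewrite !tnth_mktuple addrC addKr.
Qed.

Lemma vaddA a x z : vadd a (vadd x z) = vadd (vadd a x) z.
Proof.
by apply: eq_from_tnth => i; rewrite !tnth_mktuple addrA.
Qed.

(** The exponent falls short of |z|^2 / (2 s^2) by |z - a|^2 / (2 s^2). This
    bound, uniform in a, makes every density below bounded in its input. *)
Lemma tilt_le (s : R) a z :
  (tilt s a z <= expR (vsqnorm z / (2 * s ^+ 2)))%R.
Proof.
rewrite ler_expR [leRHS](_ : _ = vsqnorm z / 2 / s ^+ 2)%R; last first.
  by rewrite invfM mulrA.
rewrite ler_wpM2r ?invr_ge0 ?sqr_ge0//.
rewrite /vdot /vsqnorm !mulr_sumr mulr_suml -sumrB ler_sum// => i _.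
rewrite -subr_ge0 (_ : _ - _ = 2^-1 * (tnth a i - tnth z i) ^+ 2)%R.
  by rewrite mulr_ge0// sqr_ge0.
by field.
Qed.

Lemma tilt_sqr (s : R) a z :
  (tilt s a z ^+ 2 = expR (vsqnorm a / s ^+ 2) * tilt s (vscale 2 a) z)%R.
Proof.
rewrite /tilt expr2 -!expRD vdot_scale vsqnorm_scale; congr expR.
rewrite -2!mulrDl; congr (_ / _)%R.
by field.
Qed.

Lemma ge0_integral_convolution (s : R) mu (g : d.-tuple R -> \bar R) :
  measurable_fun setT g -> (forall x, 0 <= g x) ->
  \int[convolution mu (gaussian d s)]_y g y =
  \int[mu]_x \int[gaussian d s]_z g (vadd x z).
Proof.
move=> mg g0; rewrite ge0_integral_pushforward//= fubini_tonelli1//.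
by apply: measurableT_comp => //; exact: measurable_vadd_pair.
Qed.

(** Laws N(x, s^2 I) with different centres x are all expressed through the
    single centre m. *)
Lemma ge0_integral_gaussian_recenter (s : R) x m (g : d.-tuple R -> \bar R) :
  s != 0%R -> measurable_fun setT g -> (forall x, 0 <= g x) ->
  \int[gaussian d s]_z g (vadd x z) =
  \int[gaussian d s]_z (g (vadd m z) * (tilt s (vsub x m) z)%:E).
Proof.
move=> s0 mg g0.
rewrite -(@ge0_integral_gaussian_shift _ _ _ (vsub x m)
  (fun z => g (vadd m z)))//.
  by apply: eq_integral => z _; rewrite vaddA vsubK.
by apply: measurableT_comp => //; exact: measurable_vadd.
Qed.

End smoothing.

(** The density of P * N(0, s^2 I) at mean P + z, with respect to
    N(mean P, s^2 I). *)
Definition mixture (R : realType) (d : nat) (s : R)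
    (P : probability (d.-tuple R) R) (z : d.-tuple R) : R :=
  fine (\int[P]_x (tilt s (vsub x (mean P)) z)%:E)%E.

(** At (x, y), the density at y of N(x, s^2 I) with respect to the output law
    P * N(0, s^2 I). *)
Definition channel_density (R : realType) (d : nat) (s : R)
    (P : probability (d.-tuple R) R) (w : d.-tuple R * d.-tuple R) : R :=
  tilt s (vsub w.1 (mean P)) (vsub w.2 (mean P)) /
  mixture s P (vsub w.2 (mean P)).

Section channel.
Context (R : realType) (d : nat) (s : R) (P : probability (d.-tuple R) R).
Hypothesis s_neq0 : s != 0.
Local Open Scope ereal_scope.
Implicit Types (x y z : d.-tuple R).

Local Notation m := (mean P).
Local Notation q := (mixture s P).
Local Notation f := (channel_density s P).
Local Notation out := (convolution P (gaussian d s)).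

Let mtilt : measurable_fun setT
  (fun w : d.-tuple R * d.-tuple R => (tilt s (vsub w.1 m) w.2)%:E).
Proof.
apply/measurable_EFinP; apply: measurable_tilt => //.
exact: measurable_vsub.
Qed.

Lemma mixtureE z : \int[P]_x (tilt s (vsub x m) z)%:E = (q z)%:E.
Proof.
rewrite /mixture fineK// ge0_fin_numE ?integral_ge0//; last first.
  by move=> x _; rewrite lee_fin tilt_ge0.
apply: (@le_lt_trans _ _ (\int[P]_x (expR (vsqnorm z / (2 * s ^+ 2)))%:E)).
  apply: ge0_le_integral => //.
  - by move=> x _; rewrite lee_fin tilt_ge0.
  - apply/measurable_EFinP; apply: measurable_tilt => //.
    exact: measurable_vsub.
  - by move=> x _; rewrite lee_fin tilt_le.
by rewrite integral_cst//= probability_setT mule1 ltry.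
Qed.

Lemma measurable_mixture : measurable_fun setT q.
Proof.
apply: measurableT_comp => //.
apply: (measurable_fun_fubini_tonelli_G
  (fun w : d.-tuple R * d.-tuple R => (tilt s (vsub w.1 m) w.2)%:E)) => //.
by move=> w; rewrite lee_fin tilt_ge0.
Qed.

Lemma mixture_ge0 z : (0 <= q z)%R.
Proof.
by rewrite -lee_fin -mixtureE integral_ge0// => x _; rewrite lee_fin tilt_ge0.
Qed.

Lemma channel_density_ge0 w : (0 <= f w)%R.
Proof. by rewrite divr_ge0 ?mixture_ge0 ?tilt_ge0. Qed.

Lemma measurable_channel_density : measurable_fun setT f.
Proof.
have m2 : measurable_fun setT
    (fun w : d.-tuple R * d.-tuple R => vsub w.2 m) by exact: measurable_vsub.
apply: measurable_funM.
  by apply: measurable_tilt => //; exact: measurable_vsub.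
(* Powers are measurable on the whole line, so the inverse is written as the
   power of exponent -1. *)
under eq_fun do rewrite -powR_inv1 ?mixture_ge0//.
apply: (measurableT_comp (measurable_powR _)).
exact: (measurableT_comp measurable_mixture).
Qed.

Lemma ge0_integral_smoothed (g : d.-tuple R -> \bar R) :
  measurable_fun setT g -> (forall x, 0 <= g x) ->
  \int[out]_y g y = \int[gaussian d s]_z (g (vadd m z) * (q z)%:E).
Proof.
move=> mg g0; rewrite ge0_integral_convolution//.
have mgm : measurable_fun setT (fun z => g (vadd m z)).
  by apply: measurableT_comp => //; exact: measurable_vadd.
transitivity (\int[P]_x \int[gaussian d s]_z
    (g (vadd m z) * (tilt s (vsub x m) z)%:E)).
  by apply: eq_integral => x _; exact: ge0_integral_gaussian_recenter.
rewrite (fubini_tonelli (m1 := P) (m2 := gaussian d s)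
  (fun w => g (vadd m w.2) * (tilt s (vsub w.1 m) w.2)%:E)).
- apply: eq_integral => z _ /=.
  rewrite ge0_integralZl// ?mixtureE//.
    apply/measurable_EFinP; apply: measurable_tilt => //.
    exact: measurable_vsub.
  by move=> x _; rewrite lee_fin tilt_ge0.
- apply: emeasurable_funM => //.
  exact: (measurableT_comp mgm).
- by move=> w; rewrite mule_ge0// lee_fin tilt_ge0.
Qed.

Hypothesis q_gt0 : forall z, (0 < q z)%R.

Lemma ge0_integral_channel_density x (g : d.-tuple R -> \bar R) :
  measurable_fun setT g -> (forall x, 0 <= g x) ->
  \int[gaussian d s]_z g (vadd x z) = \int[out]_y (g y * (f (x, y))%:E).
Proof.
move=> mg g0; rewrite (ge0_integral_gaussian_recenter x m)//.
rewrite ge0_integral_smoothed.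
- apply: eq_integral => z _; rewrite -muleA -EFinM /channel_density/= vaddK.
  by rewrite divfK// gt_eqF.
- apply: emeasurable_funM => //; apply/measurable_EFinP.
  apply: (measurableT_comp measurable_channel_density).
  exact: measurable_pair1.
- by move=> y; rewrite mule_ge0// lee_fin channel_density_ge0.
Qed.

Lemma integral_channel_density1 y : \int[P]_x (f (x, y))%:E = 1.
Proof.
rewrite /channel_density/=.
under eq_integral do rewrite EFinM.
rewrite ge0_integralZr//.
- by rewrite mixtureE -EFinM divff// gt_eqF.
- apply/measurable_EFinP; apply: measurable_tilt => //.
  exact: measurable_vsub.
- by move=> x _; rewrite lee_fin tilt_ge0.
- by rewrite lee_fin invr_ge0 mixture_ge0.
Qed.

Lemma integral_channel_density2 x : \int[out]_y (f (x, y))%:E = 1.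
Proof.
have := @ge0_integral_channel_density x (cst 1).
rewrite integral_cst//= probability_setT mule1 => -> //.
by apply: eq_integral => y _; rewrite mul1e.
Qed.

Lemma channel_density_le x y :
  (f (x, y) <= expR (vsqnorm (vsub y m) / (2 * s ^+ 2)) / q (vsub y m))%R.
Proof. by rewrite ler_wpM2r ?invr_ge0 ?mixture_ge0 ?tilt_le. Qed.

(** Against the output law, f(x, .)^2 becomes tilt^2 / q against the Gaussian;
    1 / q <= M, and tilt^2 is a multiple of the density of another translate of
    the Gaussian ([tilt_sqr]). *)
Lemma le_integral_channel_density_sqr (M : R) x :
  (forall z, 1 <= M * q z)%R ->
  \int[out]_y (f (x, y) ^+ 2)%:E <= (M * expR (vsqnorm (vsub x m) / s ^+ 2))%:E.
Proof.
move=> Mq.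
have mf1 : measurable_fun setT (fun y => f (x, y)).
  apply: (measurableT_comp measurable_channel_density).
  exact: measurable_pair1.
rewrite ge0_integral_smoothed; first last.
- by move=> y; rewrite lee_fin sqr_ge0.
- by apply/measurable_EFinP/measurable_funX.
have M0 : (0 <= M)%R by rewrite -(pmulr_lge0 _ (q_gt0 m)) (le_trans ler01).
pose e := expR (vsqnorm (vsub x m) / s ^+ 2).
apply: (@le_trans _ _ (\int[gaussian d s]_z
    ((M * e)%:E * (tilt s (vscale 2 (vsub x m)) z)%:E))).
  apply: ge0_le_integral => //.
  - by move=> z _; rewrite -EFinM lee_fin mulr_ge0 ?sqr_ge0 ?mixture_ge0.
  - apply/measurable_EFinP/measurable_funM; last exact: measurable_mixture.
    apply: measurable_funX; apply: (measurableT_comp mf1).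
    exact: measurable_vadd.
  - apply: emeasurable_funM => //; apply/measurable_EFinP.
    exact: measurable_tilt.
  move=> z _; rewrite -!EFinM lee_fin /channel_density/= vaddK.
  rewrite [leRHS](_ : _ = M * tilt s (vsub x m) z ^+ 2)%R; last first.
    by rewrite tilt_sqr mulrA.
  rewrite [leLHS](_ : _ = (q z)^-1 * tilt s (vsub x m) z ^+ 2)%R; last first.
    by field; rewrite gt_eqF.
  by rewrite ler_wpM2r ?sqr_ge0// -div1r ler_pdivrMr.
rewrite ge0_integralZl//.
- by rewrite integral_tilt// mule1.
- by apply/measurable_EFinP; exact: measurable_tilt.
- by move=> z _; rewrite lee_fin tilt_ge0.
- by rewrite lee_fin mulr_ge0// expR_ge0.
Qed.

End channel.

(** * Bounds on second moments of densities *)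

(** Put l = <a, z> / s^2, which has mean zero, and h = |a|^2 / (2 s^2), so that
    tilt s a z = exp(l - h). For any M > 0, the inequality exp u >= 1 + u gives
    M exp(l - h) + M^-1 exp h >= (1 + ln M + l - h) + (1 + h - ln M) = 2 + l.
    As M bounds the mean of exp(2 h), hence that of exp h, taking means yields
    M q + 1 >= 2. *)
Lemma mixture_lower_bound (R : realType) (d : nat) (s K M : R)
    (P : probability (d.-tuple R) R) z :
  s != 0 -> subgaussian K P -> 0 < M ->
  (\int[P]_x (expR (vsqnorm (vsub x (mean P)) / s ^+ 2))%:E <= M%:E)%E ->
  1 <= M * mixture s P z.
Proof.
move=> s0 sub M0 PM.
pose dev x := vsub x (mean P).
have mdev : measurable_fun setT dev by exact: measurable_vsub.
pose l x := vdot (dev x) z / s ^+ 2.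
pose e x := expR (vsqnorm (dev x) / s ^+ 2).
have M'0 : 0 <= M^-1 by rewrite invr_ge0 ltW.
have il : P.-integrable setT
    (fun x => ((s ^+ 2)^-1)%:E * (vdot (dev x) z)%:E)%E.
  by apply: integrableZl => //; exact: (integrable_centered z sub).
have lE : (\int[P]_x (2 + l x)%:E = 2%:E)%E.
  transitivity (\int[P]_x (2%:E + ((s ^+ 2)^-1)%:E * (vdot (dev x) z)%:E))%E.
    by apply: eq_integral => x _; rewrite -EFinM -EFinD mulrC.
  rewrite integralD//; last exact: finite_measure_integrable_cst.
  rewrite integral_cst//= probability_setT mule1 integralZl//; last first.
    exact: (integrable_centered z sub).
  by rewrite (integral_centered z sub) mule0 adde0.
have mt : measurable_fun setT (fun x => tilt s (dev x) z).
  exact: measurable_tilt.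
have me : measurable_fun setT e.
  apply: measurableT_comp => //; apply: measurable_funM => //.
  exact: measurable_vsqnorm.
have it : P.-integrable setT (fun x => (tilt s (dev x) z)%:E).
  apply/integrableP; split; first exact/measurable_EFinP.
  under eq_integral do rewrite /= ger0_norm ?tilt_ge0//.
  by rewrite mixtureE ltry.
have ie : P.-integrable setT (EFin \o e).
  apply/integrableP; split; first exact/measurable_EFinP.
  under eq_integral do rewrite /= ger0_norm ?expR_ge0//.
  by rewrite (le_lt_trans PM)// ltry.
have pw x : 2 + l x <= M * tilt s (dev x) z + M^-1 * e x.
  set h := vsqnorm (dev x) / (2 * s ^+ 2).
  have h0 : 0 <= h.
    by rewrite divr_ge0 ?vsqnorm_ge0// mulr_ge0// sqr_ge0.
  apply: (@le_trans _ _ (expR (ln M + (l x - h)) + expR (h - ln M))).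
    rewrite (_ : 2 + l x = (1 + (ln M + (l x - h))) + (1 + (h - ln M))).
      by rewrite lerD// expR_ge1Dx.
    by ring.
  rewrite lerD//.
    rewrite expRD lnK ?posrE// ler_pM2l// ler_expR le_eqVlt.
    by apply/orP; left; apply/eqP; rewrite /l /h; field.
  rewrite addrC expRD -lnV ?posrE// lnK ?posrE ?invr_gt0//.
  rewrite ler_wpM2l// ler_expR (_ : vsqnorm _ / _ = h + h) ?lerDl//.
  by rewrite /h; field.
have : (2%:E <= (M * mixture s P z)%:E + 1%:E)%E.
  rewrite -lE; apply: (@le_trans _ _
      (\int[P]_x (M%:E * (tilt s (dev x) z)%:E + M^-1%:E * (e x)%:E)))%E.
    apply: le_integral => //.
    - apply: (eq_integrable measurableT
        (fun x => 2%:E + ((s ^+ 2)^-1)%:E * (vdot (dev x) z)%:E)%E).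
        by move=> x _; rewrite -EFinM -EFinD mulrC.
      by apply: integrableD => //; exact: finite_measure_integrable_cst.
    - by apply: integrableD => //; exact: integrableZl.
    - by move=> x _; rewrite -!EFinM -EFinD lee_fin.
  rewrite integralD//; [|exact: integrableZl..].
  rewrite !integralZl// mixtureE EFinM leeD2l//.
  rewrite (le_trans (lee_wpmul2l _ PM)) ?lee_fin//.
  by rewrite mulVf// gt_eqF.
by rewrite -EFinD lee_fin (natrD R 1 1) lerD2r.
Qed.

Section sqr_dev.
Local Open Scope ereal_scope.

(** The integral of (g - 1)^2 is that of g^2 minus 1. Adding 2 g to (g - 1)^2
    avoids subtracting integrals that may be infinite. *)
Lemma integral_sqr_dev_le d (T : measurableType d) (R : realType)
    (nu : probability T R) (g : T -> R) :
  measurable_fun setT g -> (forall x, (0 <= g x)%R) ->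
  \int[nu]_x (g x)%:E = 1 ->
  \int[nu]_x ((g x - 1) ^+ 2)%:E <= \int[nu]_x (g x ^+ 2)%:E.
Proof.
move=> mg g0 g1.
have E : \int[nu]_x ((g x - 1) ^+ 2)%:E + 2%:E =
    \int[nu]_x (g x ^+ 2)%:E + 1%:E.
  transitivity (\int[nu]_x (((g x - 1) ^+ 2)%:E + 2%:E * (g x)%:E)).
    rewrite ge0_integralD//.
    - rewrite ge0_integralZl//; first by rewrite g1 mule1.
      + exact/measurable_EFinP.
      + by move=> x _; rewrite lee_fin.
    - by move=> x _; rewrite lee_fin sqr_ge0.
    - by apply/measurable_EFinP/measurable_funX; exact: measurable_funB.
    - by move=> x _; rewrite -EFinM lee_fin mulr_ge0.
    - by apply/measurable_EFinP; exact: measurable_funM.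
  transitivity (\int[nu]_x ((g x ^+ 2)%:E + 1%:E)).
    by apply: eq_integral => x _; rewrite -EFinM -!EFinD; congr EFin; ring.
  rewrite ge0_integralD//.
  - by rewrite integral_cst//= probability_setT mule1.
  - by move=> x _; rewrite lee_fin sqr_ge0.
  - by apply/measurable_EFinP; exact: measurable_funX.
rewrite -(@leeD2rE _ 1%:E)// -E leeD2l// lee_fin.
by rewrite ler1n.
Qed.

Lemma ge0_integral_empirical d (T : measurableType d) (R : realType) n
    (s : n.+1.-tuple T) (g : T -> \bar R) :
  measurable_fun setT g -> (forall x, 0 <= g x) ->
  \int[empirical R s]_x g x =
  (n.+1%:R^-1)%:E * \sum_(i < n.+1) g (tnth s i).
Proof.
move=> mg g0.
transitivity (\int[mscale ((n.+1%:R^-1)%:nng)%R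
    (msum (fun k => dirac (nth (thead s) s k)) n.+1)]_x g x).
  apply: eq_measure_integral => A _ _.
  rewrite /= /empirical /mscale/= /msum; congr (_ * _).
  by apply: eq_bigr => i _; rewrite (tnth_nth (thead s)).
rewrite ge0_integral_mscale// ge0_integral_measure_sum//.
congr (_ * _); apply: eq_bigr => i _.
by rewrite integral_dirac// diracT mul1e (tnth_nth (thead s)).
Qed.

(** For each [y] the variables [f (x_i, y) - 1] are centred, independent and
    bounded by a constant depending on [y] only, so the variance of their mean
    is the variance of one of them divided by their number; Tonelli's theorem
    then integrates this over [y]. *)
Lemma integral_iid_mean_sqr_dev d d' (T : measurableType d)
    (U : measurableType d') (R : realType) (P : probability T R)
    (nu : probability U R) (f : T * U -> R) (b : U -> R) (n : nat) :
  measurable_fun setT f -> (forall w, (0 <= f w <= b w.2)%R) ->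
  (forall y, \int[P]_x (f (x, y))%:E = 1) ->
  \int[iid P n.+1]_s \int[nu]_y
    ((n.+1%:R^-1 * (\sum_(i < n.+1) f (tnth s i, y)) - 1) ^+ 2)%:E =
  (n.+1%:R^-1)%:E * \int[P]_x \int[nu]_y ((f (x, y) - 1) ^+ 2)%:E.
Proof.
move=> mf fb f1; pose N : R := n.+1%:R.
have N0 : N != 0%R by rewrite pnatr_eq0.
have m1 y : measurable_fun setT (fun x => f (x, y)).
  by apply: (measurableT_comp mf); exact: measurable_pair2.
pose h y x : R := (f (x, y) - 1)%R.
have mh y : measurable_fun setT (h y) by exact: measurable_funB.
have mh2 : measurable_fun setT (fun w => ((f w - 1) ^+ 2)%:E).
  by apply/measurable_EFinP/measurable_funX; exact: measurable_funB.
have hb y x : (`|h y x| <= b y + 1)%R.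
  have /andP[f0 fby] := fb (x, y).
  by rewrite (le_trans (ler_normB _ _))// normr1 lerD2r ger0_norm.
have ih y : P.-integrable setT (EFin \o h y).
  apply: (le_integrable measurableT (g := cst (b y + 1)%:E)) => //.
  - exact/measurable_EFinP.
  - by move=> x _; rewrite /= lee_fin (le_trans (hb y x))// ler_norm.
  - exact: finite_measure_integrable_cst.
have ih2 y : P.-integrable setT (fun x => (h y x ^+ 2)%:E).
  apply: (le_integrable measurableT (g := cst ((b y + 1) ^+ 2)%:E)) => //.
  - by apply/measurable_EFinP; exact: measurable_funX.
  - move=> x _; rewrite /= lee_fin !normrX lerXn2r ?nnegrE//.
    by rewrite (le_trans (hb y x))// ler_norm.
  - exact: finite_measure_integrable_cst.
have h0 y : \int[P]_x (h y x)%:E = 0.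
  under eq_integral do rewrite /h EFinB.
  rewrite integralB//.
  - by rewrite f1 integral_cst//= probability_setT mule1 subee.
  - apply: (eq_integrable measurableT (fun x => (h y x)%:E + 1%:E)).
      by move=> x _; rewrite /h -EFinD subrK.
    apply: integrableD => //; first exact: ih.
    exact: finite_measure_integrable_cst.
  - exact: finite_measure_integrable_cst.
pose v y : R := fine (\int[P]_x (h y x ^+ 2)%:E).
have vE y : \int[P]_x (h y x ^+ 2)%:E = (v y)%:E.
  by rewrite /v fineK//; exact: integrable_fin_num.
rewrite (fubini_tonelli (m1 := iid P n.+1) (m2 := nu) (fun w =>
  ((N^-1 * (\sum_(i < n.+1) f (tnth w.1 i, w.2)) - 1) ^+ 2)%:E)).
- rewrite [in RHS](fubini_tonelli (m1 := P) (m2 := nu)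
    (fun w => ((f w - 1) ^+ 2)%:E))//; last first.
    by move=> w; rewrite lee_fin sqr_ge0.
  rewrite -ge0_integralZl//; first last.
  + by move=> y _; apply: integral_ge0 => x _; rewrite lee_fin sqr_ge0.
  + apply: (measurable_fun_fubini_tonelli_G
      (fun w => ((f w - 1) ^+ 2)%:E)) => //.
    by move=> w; rewrite lee_fin sqr_ge0.
  apply: eq_integral => y _; rewrite [in RHS]vE -EFinM.
  transitivity (\int[iid P n.+1]_s ((N ^- 2)%:E *
      ((0 + \sum_(i < n.+1) h y (tnth s i)) ^+ 2)%:E)).
    apply: eq_integral => s _; rewrite -EFinM; congr EFin.
    rewrite /h sumrB sumr_const card_ord add0r -/N -exprVn -exprMn.
    by congr (_ ^+ 2)%R; rewrite mulrBr mulVf.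
  rewrite ge0_integralZl//.
  + rewrite (integral_iid_sum_sqr n.+1 0 (ih y) (ih2 y) (h0 y) (vE y)).
    by rewrite -EFinM -/N; congr EFin; field.
  + apply/measurable_EFinP/measurable_funX; apply: measurable_funD => //.
    apply: measurable_sum => i; apply: (measurableT_comp (mh y)).
    exact: measurable_tnth.
  + by move=> s _; rewrite lee_fin sqr_ge0.
  + by rewrite lee_fin invr_ge0 sqr_ge0.
- apply/measurable_EFinP/measurable_funX; apply: measurable_funB => //.
  apply: measurable_funM => //; apply: measurable_sum => i.
  apply: (measurableT_comp mf); apply: measurable_fun_pair => //.
  exact: (measurableT_comp (measurable_tnth i)).
- by move=> w; rewrite lee_fin sqr_ge0.
Qed.

End sqr_dev.

(** * Densities with respect to the output law *)

Section densities.
Context (R : realType) (d : nat) (s : R) (P : probability (d.-tuple R) R).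
Hypotheses (s_neq0 : s != 0) (q_gt0 : forall z, 0 < mixture s P z).
Local Open Scope ereal_scope.

Local Notation f := (channel_density s P).
Local Notation out := (convolution P (gaussian d s)).

Let mf : measurable_fun setT f.
Proof. exact: measurable_channel_density. Qed.

Let mfE : measurable_fun setT (EFin \o f).
Proof. exact/measurable_EFinP. Qed.

Let f_ge0 w : 0 <= (f w)%:E.
Proof. by rewrite lee_fin channel_density_ge0. Qed.

(** Given its input x, the output has density f(x, .); averaging over the
    input law [mu] gives the density of the output. *)
Lemma convolution_density (mu : probability (d.-tuple R) R) A :
  measurable A ->
  convolution mu (gaussian d s) A =
  \int[out]_(y in A) \int[mu]_x (f (x, y))%:E.
Proof.
move=> mA; have m1A : measurable_fun setT (EFin \o (\1_A : _ -> R)).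
  by apply/measurable_EFinP; exact: measurable_indic.
have ind0 y : 0 <= (\1_A y : R)%:E by rewrite lee_fin.
transitivity (\int[convolution mu (gaussian d s)]_y (\1_A y : R)%:E).
  by rewrite integral_indic// setIT.
rewrite ge0_integral_convolution//.
transitivity (\int[mu]_x \int[out]_y ((\1_A y)%:E * (f (x, y))%:E)).
  by apply: eq_integral => x _; rewrite -ge0_integral_channel_density.
rewrite (fubini_tonelli (m1 := mu) (m2 := out)
  (fun w => (\1_A w.2)%:E * (f w)%:E)).
- rewrite [RHS]integral_mkcond; apply: eq_integral => y _.
  rewrite epatch_indic muleC -ge0_integralZl; first by [].
  + exact: measurableT.
  + by apply: (measurableT_comp mfE); exact: measurable_pair2.
  + by move=> x _; exact: f_ge0.
  + exact: ind0.
- - by apply: emeasurable_funM => //; exact: (measurableT_comp m1A).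
- by move=> w; rewrite mule_ge0.
Qed.

Lemma joint_density (A : set (d.-tuple R * d.-tuple R)) : measurable A ->
  \int[P]_x \int[gaussian d s]_z (\1_A (x, vadd x z))%:E =
  \int[P \x out]_(w in A) (f w)%:E.
Proof.
move=> mA; have m1A : measurable_fun setT (EFin \o (\1_A : _ -> R)).
  by apply/measurable_EFinP; exact: measurable_indic.
rewrite [RHS]integral_mkcond fubini_tonelli1; first last.
- by move=> w; apply: erestrict_ge0.
- by apply/(measurable_restrictT _ _).1 => //; exact: measurable_funTS.
apply: eq_integral => x _.
rewrite (ge0_integral_channel_density s_neq0 q_gt0 x
  (g := fun y => (\1_A (x, y))%:E)).
- by apply: eq_integral => y _; rewrite epatch_indic muleC.
- by apply: (measurableT_comp m1A); exact: measurable_pair1.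
- by move=> y; rewrite lee_fin.
Qed.

Lemma integral_channel_density_sqr_dev_le (M : R) :
  (forall z, 1 <= M * mixture s P z)%R ->
  \int[P]_x (expR (vsqnorm (vsub x (mean P)) / s ^+ 2))%:E <= M%:E ->
  \int[P]_x \int[out]_y ((f (x, y) - 1) ^+ 2)%:E <= (M ^+ 2)%:E.
Proof.
move=> Mq PM.
have M0 : (0 <= M)%R.
  by rewrite -(pmulr_lge0 _ (q_gt0 (mean P))) (le_trans ler01).
have me : measurable_fun setT
    (fun x : d.-tuple R => (expR (vsqnorm (vsub x (mean P)) / s ^+ 2))%:E).
  apply/measurable_EFinP/measurableT_comp => //; apply: measurable_funM => //.
  by apply: measurable_vsqnorm; exact: measurable_vsub.
apply: (@le_trans _ _ (\int[P]_x
    (M%:E * (expR (vsqnorm (vsub x (mean P)) / s ^+ 2))%:E))); last first.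
  by rewrite ge0_integralZl// expr2 EFinM lee_wpmul2l// lee_fin.
apply: ge0_le_integral => //.
- by move=> x _; apply: integral_ge0 => y _; rewrite lee_fin sqr_ge0.
- apply: (measurable_fun_fubini_tonelli_F (fun w => ((f w - 1) ^+ 2)%:E)).
    by apply/measurable_EFinP/measurable_funX; exact: measurable_funB.
  by move=> w; rewrite lee_fin sqr_ge0.
- exact: measurable_funeM.
move=> x _.
apply: (le_trans _ (le_integral_channel_density_sqr s_neq0 q_gt0 x Mq)).
apply: integral_sqr_dev_le.
- by apply: (measurableT_comp mf); exact: measurable_pair1.
- by move=> y; exact: channel_density_ge0.
- exact: integral_channel_density2.
Qed.

End densities.

(** * Laws of the additive noise channel *)

Section additive_noise.
Local Open Scope ereal_scope.
Context (R : realType) (d : nat) (P Q : probability (d.-tuple R) R).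
Context (dO : measure_display) (Omega : measurableType dO)
  (Pr : probability Omega R) (S Z Y : {RV Pr >-> d.-tuple R}).
Hypotheses
  (lawS : forall A, measurable A -> distribution Pr S A = P A)
  (lawZ : forall A, measurable A -> distribution Pr Z A = Q A)
  (indep : independent S Z)
  (YE : forall w, Y w = vadd (S w) (Z w)).

Lemma independent_joint_law A : measurable A ->
  distribution Pr (rv_pair S Z) A = (P \x Q) A.
Proof.
move=> mA; apply/esym; apply: product_measure_unique => // B C mB mC.
apply: (etrans (indep mB mC)).
by congr (_ * _); [exact: lawS|exact: lawZ].
Qed.

Lemma sum_law A : measurable A -> distribution Pr Y A = convolution P Q A.
Proof.
move=> mA; rewrite /convolution /= /pushforward -independent_joint_law.
  by congr (Pr _); apply/seteqP; split => w /=; rewrite /vadd_pair/= YE.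
by rewrite -[X in measurable X]setTI; exact: measurable_vadd_pair.
Qed.

Lemma input_output_law A : measurable A ->
  distribution Pr (rv_pair S Y) A =
  \int[P]_x \int[Q]_z (\1_A (x, vadd x z))%:E.
Proof.
move=> mA.
pose g (w : d.-tuple R * d.-tuple R) := (w.1, vadd w.1 w.2).
have mg : measurable_fun setT g.
  by apply: measurable_fun_pair => //; exact: measurable_vadd.
have mgA : measurable (g @^-1` A).
  by rewrite -[X in measurable X]setTI; exact: mg.
transitivity ((P \x Q) (g @^-1` A)).
  rewrite -independent_joint_law// /distribution/= /pushforward.
  by congr (Pr _); apply/seteqP; split => w /=; rewrite /rv_pair/g/= YE.
transitivity (\int[P \x Q]_w (\1_(g @^-1` A) w : R)%:E).
  by rewrite integral_indic// setIT.
rewrite fubini_tonelli1//.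
by apply/measurable_EFinP; exact: measurable_indic.
Qed.

Lemma input_output_product_law A : measurable A ->
  (distribution Pr S \x distribution Pr Y) A = (P \x convolution P Q) A.
Proof.
move=> mA; apply: product_measure_unique => // B C mB mC.
rewrite /= product_measure1E//.
by congr (_ * _); apply/esym; [exact: lawS|exact: sum_law].
Qed.

End additive_noise.

(** * The mutual information bound *)

(** With r = (K / s)^2, the left-hand side is (1 - 2 r)^(-d), and
    1 / (1 - 2 r) = 1 + 2 r / (1 - 2 r) <= exp(2 r / (1 - 2 r)). The exponent is
    compared with that of the right-hand side by (1 - 2 r)^2 >= 1 - 4 r. *)
Lemma gaussian_constant_le (R : realType) (d : nat) (s K : R) :
  0 < s -> 0 < K -> K < s / 2 ->
  ((Num.sqrt (1 - 2 * (K / s) ^+ 2))^-1 ^+ d) ^+ 2 <=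
  expR (2 * d%:R * (K / s) ^+ 2 *
        ((s ^+ 2 - 2 * K ^+ 2) / (s ^+ 2 - 4 * K ^+ 2))).
Proof.
move=> s0 K0 Ks; set r := (K / s) ^+ 2.
have s20 : 0 < s ^+ 2 by rewrite exprn_gt0.
have r0 : 0 <= r by rewrite sqr_ge0.
have r4 : 0 < 1 - 4 * r.
  have t2 : K / s < 2^-1 by rewrite ltr_pdivrMr// mulrC.
  have t0 : 0 <= K / s by rewrite divr_ge0 ?ltW.
  rewrite subr_gt0 /r; nra.
have r2 : 0 < 1 - 2 * r by lra.
have -> : (s ^+ 2 - 2 * K ^+ 2) / (s ^+ 2 - 4 * K ^+ 2) =
    (1 - 2 * r) / (1 - 4 * r).
  have rE : K ^+ 2 = r * s ^+ 2 by rewrite /r; field; rewrite gt_eqF.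
  have -> : s ^+ 2 - 2 * K ^+ 2 = s ^+ 2 * (1 - 2 * r) by rewrite rE; ring.
  have -> : s ^+ 2 - 4 * K ^+ 2 = s ^+ 2 * (1 - 4 * r) by rewrite rE; ring.
  by rewrite -mulf_div divff ?mul1r// gt_eqF.
clearbody r.
rewrite -exprM mulnC exprM exprVn sqr_sqrtr; last exact: ltW.
have -> : 2 * d%:R * r * ((1 - 2 * r) / (1 - 4 * r)) =
    (2 * r * ((1 - 2 * r) / (1 - 4 * r))) * d%:R by ring.
rewrite expRM_natr lerXn2r ?nnegrE ?invr_ge0 ?expR_ge0 ?(ltW r2)//.
apply: (le_trans _ (expR_ge1Dx _)).
rewrite (_ : (1 - 2 * r)^-1 = 1 + 2 * r / (1 - 2 * r)); last first.
  by field; rewrite gt_eqF.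
rewrite lerD2l -!mulrA ler_wpM2l// ler_wpM2l//.
rewrite ler_pdivlMr// mulrC ler_pdivrMr//; nra.
Qed.

Theorem proposition3 (R : realType) (d : nat) (sigma K : R)
    (P : probability (d.-tuple R) R) :
  (1 <= d)%N -> 0 < sigma -> 0 < K -> K < sigma / 2 -> subgaussian K P ->
  let c := expR (2 * d%:R * (K / sigma) ^+ 2 *
                 ((sigma ^+ 2 - 2 * K ^+ 2) / (sigma ^+ 2 - 4 * K ^+ 2))) in
  (forall (dO : measure_display) (Omega : measurableType dO)
          (Pr : probability Omega R) (S Z Y : {RV Pr >-> d.-tuple R}),
     (forall A, measurable A -> distribution Pr S A = P A) ->
     (forall A, measurable A -> distribution Pr Z A = gaussian d sigma A) ->
     independent S Z ->
     (forall w, Y w = vadd (S w) (Z w)) ->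
     (chi2_info S Y <= c%:E < +oo)%E) /\
  (forall n : nat,
     (\int[iid P n.+1]_s
        chi2_div (convolution (empirical R s) (gaussian d sigma))
                 (convolution P (gaussian d sigma))
      <= (c / n.+1%:R)%:E)%E).
Proof.
move=> _ s0 K0 Ks sub c.
have sn0 : sigma != 0 by rewrite gt_eqF.
pose M : R := (Num.sqrt (1 - 2 * (K / sigma) ^+ 2))^-1 ^+ d.
have K2s2 : 2 * K ^+ 2 < sigma ^+ 2 by nra.
have Mc : M ^+ 2 <= c by exact: gaussian_constant_le.
have PM := subgaussian_expR_vsqnorm s0 K2s2 sub; rewrite -/M in PM.
have M0 : 0 < M.
  rewrite exprn_gt0// invr_gt0 sqrtr_gt0 subr_gt0 expr_div_n mulrA.
  by rewrite ltr_pdivrMr ?mul1r// exprn_gt0.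
have Mq z : 1 <= M * mixture sigma P z by exact: mixture_lower_bound sub M0 PM.
have q0 z : 0 < mixture sigma P z.
  by rewrite -(pmulr_rgt0 _ M0) (lt_le_trans ltr01).
pose f := channel_density sigma P.
have mf : measurable_fun setT f by exact: measurable_channel_density.
have f0 w : 0 <= f w by exact: channel_density_ge0.
pose out := convolution P (gaussian d sigma).
have fc : (\int[P]_x \int[out]_y ((f (x, y) - 1) ^+ 2)%:E <= c%:E)%E.
  apply: (le_trans (integral_channel_density_sqr_dev_le sn0 q0 Mq PM)).
  by rewrite lee_fin.
have mdev : measurable_fun setT (fun w => ((f w - 1) ^+ 2)%:E).
  by apply/measurable_EFinP/measurable_funX; exact: measurable_funB.
split=> [dO Omega Pr S Z Y lawS lawZ indep YE|n].
  rewrite ltry andbT.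
  have lawSY := input_output_product_law lawS lawZ indep YE.
  rewrite /chi2_info (density_chi2_div mf f0).
    rewrite (eq_measure_integral (P \x out)%E); last first.
      by move=> A mA _; exact: lawSY.
    rewrite fubini_tonelli1// => w.
    by rewrite lee_fin sqr_ge0.
  move=> A mA; apply: (etrans (input_output_law lawS lawZ indep YE mA)).
  rewrite (joint_density sn0 q0)//.
  by apply: eq_measure_integral => B mB _; exact/esym/lawSY.
have m2 (x : d.-tuple R) : measurable_fun setT (fun y => f (x, y)).
  by apply: (measurableT_comp mf); exact: measurable_pair1.
have m1 (y : d.-tuple R) : measurable_fun setT (fun x => (f (x, y))%:E).
  apply/measurable_EFinP.
  by apply: (measurableT_comp mf); exact: measurable_pair2.
pose b y :=
  expR (vsqnorm (vsub y (mean P)) / (2 * sigma ^+ 2)) /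
  mixture sigma P (vsub y (mean P)).
have fb w : 0 <= f w <= b w.2.
  by case: w => x y; rewrite f0; exact: channel_density_le.
(* The density of the smoothed empirical law of the sample s. *)
have fbar (s : n.+1.-tuple (d.-tuple R)) y :
    (\int[empirical R s]_x (f (x, y))%:E =
     (n.+1%:R^-1 * \sum_(i < n.+1) f (tnth s i, y))%:E)%E.
  rewrite ge0_integral_empirical//; last by move=> x; rewrite lee_fin.
  by rewrite sumEFin.
rewrite [leLHS](_ : _ = \int[iid P n.+1]_s \int[out]_y
    ((n.+1%:R^-1 * (\sum_(i < n.+1) f (tnth s i, y)) - 1) ^+ 2)%:E)%E;
    last first.
  apply: eq_integral => s _; apply: density_chi2_div.
  - apply: measurable_funM; first exact: measurable_cst.
    by apply: measurable_sum => i; exact: m2.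
  - by move=> y; rewrite mulr_ge0 ?invr_ge0// sumr_ge0.
  - move=> A mA; rewrite (convolution_density sn0 q0)//.
    by apply: eq_integral => y _; exact: fbar.
rewrite (integral_iid_mean_sqr_dev out n mf fb); last first.
  exact: integral_channel_density1.
by rewrite mulrC EFinM lee_wpmul2l// lee_fin invr_ge0.
Qed.
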